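(* For each natural number $n\geq 8$, there exists an $n$-element lattice $L(n)$ that is not dismantlable, has exactly $2^{n-5}$ congruences (that is, $|\mathrm{Con}(L(n))| = 2^{n-5}$), and is not planar.
   Context: $\mathrm{Con}(L)$ denotes the set (lattice) of all lattice congruences of a lattice $L$. An $n$-element finite lattice $L$ is dismantlable if there is a sequence $L_1\subset L_2\subset\dots\subset L_n=L$ of its sublattices such that $|L_i|=i$ for every $i\in\{1,\dots,n\}$. A lattice is called planar if it is finite and has a Hasse diagram that is a planar representation of a graph in the usual sense that any two edges can intersect only at vertices. (As usual, a Hasse diagram of a finite ordered set represents its elements by distinct points of the Euclidean plane so that $x<y$ implies that the point of $y$ has strictly larger second coordinate than the point of $x$, and each covering pair $x\prec y$ is represented by the straight line segment joining the two points, this segment containing no point representing an element other than its endpoints.) *)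

(* Defs.v *)
From HB Require Import structures.
From mathcomp Require Import all_boot all_order all_algebra reals.

Set Implicit Arguments.
Unset Strict Implicit.
Unset Printing Implicit Defensive.

Import Order.TTheory GRing.Theory Num.Theory.

Local Open Scope order_scope.

Section Lattices.
Variables (d : Order.disp_t) (L : finLatticeType d).
Implicit Types (r : {set L * L}) (S : {set L}) (x y : L).

Definition is_congruence r : bool :=
  [&& [forall x, (x, x) \in r],
      [forall x, forall y, ((x, y) \in r) ==> ((y, x) \in r)],
      [forall x, forall y, forall z,
         ((x, y) \in r) && ((y, z) \in r) ==> ((x, z) \in r)],
      [forall x, forall y, forall u, forall v,
         ((x, y) \in r) && ((u, v) \in r) ==> ((x `&` u, y `&` v) \in r)] &
      [forall x, forall y, forall u, forall v,
         ((x, y) \in r) && ((u, v) \in r) ==> ((x `|` u, y `|` v) \in r)]].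

Definition Con : {set {set L * L}} := [set r | is_congruence r].

Definition is_sublattice S : Prop :=
  [/\ S != set0,
      {in S &, forall x y, x `&` y \in S}
    & {in S &, forall x y, x `|` y \in S}].

(* Only the values C i with 1 <= i <= #|L| are relevant. *)
Definition dismantlable : Prop :=
  exists C : nat -> {set L},
    [/\ forall i, (1 <= i <= #|L|)%N -> is_sublattice (C i) /\ #|C i| = i,
        forall i, (1 <= i < #|L|)%N -> C i \proper C i.+1
      & C #|L| = [set: L]].

Definition covers x y : Prop := x < y /\ forall z, ~ (x < z < y).

End Lattices.

Section Planarity.
Variable R : realType.
Local Open Scope ring_scope.

(* Points of the Euclidean plane are pairs of reals; the second coordinate is the height. *)
Definition on_segment (a b p : R * R) : Prop :=
  exists2 t : R, 0 <= t <= 1 &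
    p = ((1 - t) * a.1 + t * b.1, (1 - t) * a.2 + t * b.2).

Section Diagrams.
Variables (d : Order.disp_t) (L : finLatticeType d).

(* A Hasse diagram is determined by the points pos x representing the
   elements x, its edges being the straight segments between covering pairs. *)
Definition is_Hasse_diagram (pos : L -> R * R) : Prop :=
  [/\ injective pos,
      forall x y : L, (x < y)%O -> (pos x).2 < (pos y).2
    & forall x y : L, covers x y ->
        forall z : L, on_segment (pos x) (pos y) (pos z) -> z = x \/ z = y].

Definition is_planar_diagram (pos : L -> R * R) : Prop :=
  forall x y x' y' : L, covers x y -> covers x' y' -> (x, y) <> (x', y') ->
    forall p : R * R,
      on_segment (pos x) (pos y) p -> on_segment (pos x') (pos y') p ->
      exists z : L, p = pos z.

Definition planar : Prop :=
  exists pos : L -> R * R, is_Hasse_diagram pos /\ is_planar_diagram pos.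

End Diagrams.
End Planarity.

Arguments Con {d} L.
Arguments dismantlable {d} L.
Arguments planar R {d} L.

(* Main.v *)
From HB Require Import structures.
Require Import Defs.
From mathcomp Require Import all_boot all_order all_algebra reals.
From mathcomp Require Import topology normedtype.
From mathcomp Require Import ring.

(** The eight-element Boolean lattice, the cube, is taken for n = 8, and each
further element is added as a new top.

- Congruences.  In a finite Boolean lattice a congruence is determined by the
  largest element k congruent to the bottom, being the relation that identifies
  x and y when their joins with k agree; so there are as many congruences as
  elements ([card_Con_boolean]), and the cube has 8 = 2^(8 - 5).  Adding a new
  top doubles the number of congruences, because the only new freedom is
  whether the new top is collapsed with the old one ([card_Con_add_top]).
- Dismantlability.  If a lattice is built up one element at a time through
  sublattices, then the last element of a finite subset S to be added is
  neither a meet nor a join of two other elements of S.  Every element of the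
  cube is a meet or a join of two others, and this remains true of the copy of
  the cube at the bottom of the larger lattices
  ([cube_embedding_not_dismantlable]).
- Planarity.  In a planar diagram the three edges leaving the bottom of the
  cube are ordered from left to right just above it, say towards the atoms i, j
  and k.  The chains through i and through k up to the join of i and k enclose
  a bounded region which the chain from the bottom through j and the join of i
  and j to the top of the cube enters at its lowest point.  That chain ends
  higher than the region, so it must leave it; but it shares only the bottom
  with the two chains on the boundary, so a crossing occurs inside two edges
  ([cube_embedding_not_planar]).  The argument is carried out with chains as
  graphs of continuous functions of the height, compared by the intermediate
  value theorem ([polylines_order]). *)

Set Implicit Arguments.
Unset Strict Implicit.
Unset Printing Implicit Defensive.

Import Order.Theory GRing.Theory Num.Theory.
Import Order.DefaultSetSubsetOrder.
Import numFieldNormedType.Exports.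

(** * Congruences of finite Boolean lattices *)

Section Congruences.
Local Open Scope order_scope.
Variables (d : Order.disp_t) (L : finLatticeType d).
Implicit Types (r : {set L * L}).

Lemma ConP r :
  reflect [/\ forall x, (x, x) \in r,
      forall x y, (x, y) \in r -> (y, x) \in r,
      forall x y z, (x, y) \in r -> (y, z) \in r -> (x, z) \in r,
      forall x y u v, (x, y) \in r -> (u, v) \in r ->
        (x `&` u, y `&` v) \in r &
      forall x y u v, (x, y) \in r -> (u, v) \in r ->
        (x `|` u, y `|` v) \in r]
    (r \in Con L).
Proof.
rewrite inE; apply: (iffP and5P).
  case=> /forallP H1 /forallP H2 /forallP H3 /forallP H4 /forallP H5.
  split=> [//|x y xy|x y z xy yz|x y u v xy uv|x y u v xy uv].
  - by have /forallP/(_ y)/implyP/(_ xy) := H2 x.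
  - have /forallP/(_ y)/forallP/(_ z)/implyP := H3 x; apply.
    by rewrite xy.
  - have /forallP/(_ y)/forallP/(_ u)/forallP/(_ v)/implyP := H4 x; apply.
    by rewrite xy.
  - have /forallP/(_ y)/forallP/(_ u)/forallP/(_ v)/implyP := H5 x; apply.
    by rewrite xy.
case=> H1 H2 H3 H4 H5; split.
- exact/forallP.
- by apply/forallP=> x; apply/forallP=> y; apply/implyP; apply: H2.
- apply/forallP=> x; apply/forallP=> y; apply/forallP=> z.
  by apply/implyP=> /andP[]; apply: H3.
- apply/forallP=> x; apply/forallP=> y; apply/forallP=> u; apply/forallP=> v.
  by apply/implyP=> /andP[]; apply: H4.
- apply/forallP=> x; apply/forallP=> y; apply/forallP=> u; apply/forallP=> v.
  by apply/implyP=> /andP[]; apply: H5.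
Qed.

End Congruences.

Section BooleanCongruences.
Local Open Scope order_scope.
Variables (d : Order.disp_t) (B : finCTBDistrLatticeType d).
Implicit Types x y k : B.

Definition join_congruence k : {set B * B} :=
  [set p | p.1 `|` k == p.2 `|` k].

(** The element k is recovered as the largest element congruent to the
bottom. *)
Lemma join_congruence_inj : injective join_congruence.
Proof.
move=> k l kl.
have H a b : a \in [:: k; l] -> b \in [:: k; l] -> a <= b.
  move=> ain bin; have : (a, \bot) \in join_congruence a.
    by rewrite inE /= joinxx join0x.
  suff -> : join_congruence a = join_congruence b.
    by rewrite inE /= join0x => /eqP ab; rewrite -[X in _ <= X]ab leUl.
  by move: ain bin; rewrite !inE => /orP[]/eqP-> /orP[]/eqP->.
by apply/le_anti; rewrite !H // !inE eqxx ?orbT.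
Qed.

(** Distributivity is what makes the relation compatible with meets. *)
Lemma join_congruence_Con k : join_congruence k \in Con B.
Proof.
apply/ConP; split=> [x|x y|x y z|x y u v|x y u v]; rewrite !inE /=.
- by [].
- by rewrite eq_sym.
- by move=> /eqP-> /eqP->.
- by rewrite !joinIl => /eqP-> /eqP->.
- have joink (a b : B) : (a `|` b) `|` k = (a `|` k) `|` (b `|` k).
    by rewrite joinACA joinxx.
  by rewrite !joink => /eqP-> /eqP->.
Qed.

(** Take for k the join of the block of the bottom.  If x and y are congruent,
meeting both with the complement of y shows that x minus y is congruent to the
bottom, hence lies below k. *)
Lemma Con_boolean_join_congruence (r : {set B * B}) :
  r \in Con B -> exists k, r = join_congruence k.
Proof.
case/ConP=> rxx rsym rtr rI rU.
pose k : B := \join_(x | (x, \bot) \in r) x.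
have k0 : (k, \bot) \in r.
  rewrite /k; elim/big_rec: _ => // x y x0 y0.
  by rewrite -[\bot]joinxx; apply: rU.
have kr x : (x `|` k, x) \in r.
  by have := rU _ _ _ _ (rxx x) k0; rewrite joinx0.
have H x y : (x, y) \in r -> x <= y `|` k.
  move=> xy; have := rI _ _ _ _ xy (rxx (~` y)); rewrite -!diffE diffxx => x0.
  by rewrite -leBLR; apply: (@joins_sup _ B B _ [pred z | (z, \bot) \in r] id).
exists k; apply/setP=> -[x y]; rewrite inE /=; apply/idP/eqP => [xy|xy].
  by apply/le_anti; rewrite !leUx !leUr !H // rsym.
by apply: rtr (kr y); rewrite -xy; apply: rsym.
Qed.

Lemma card_Con_boolean : #|Con B| = #|B|.
Proof.
rewrite -(card_imset [in B] join_congruence_inj).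
apply: eq_card => r; apply/idP/imsetP.
  by case/Con_boolean_join_congruence=> k ->; exists k.
by case=> k _ ->; exact: join_congruence_Con.
Qed.

End BooleanCongruences.

(** * Adding a new top *)

Section AddTop.
Local Open Scope order_scope.
Variables (d : Order.disp_t) (L : finTBLatticeType d).

(** The new top is [None].  The alias keeps the order apart from any other
structure on option types. *)
Definition add_top := option L.
HB.instance Definition _ := Finite.on add_top.
Implicit Types x y z : add_top.

Definition add_top_le x y :=
  match x, y with
  | _, None => true
  | None, Some _ => false
  | Some a, Some b => a <= b
  end.

Definition add_top_meet x y : add_top :=
  match x, y with
  | None, _ => y
  | _, None => x
  | Some a, Some b => Some (a `&` b)
  end.

Definition add_top_join x y : add_top :=
  match x, y with
  | Some a, Some b => Some (a `|` b)
  | _, _ => None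
  end.

Fact add_top_le_refl : reflexive add_top_le.
Proof. by case=> /=. Qed.

Fact add_top_le_anti : antisymmetric add_top_le.
Proof. by case=> [a|] [b|] //= /le_anti->. Qed.

Fact add_top_le_trans : transitive add_top_le.
Proof. by case=> [a|] [b|] [c|] //=; apply: le_trans. Qed.

HB.instance Definition _ := Order.Le_isPOrder.Build d add_top
  add_top_le_refl add_top_le_anti add_top_le_trans.

Fact add_top_meetP x y z :
  (x <= add_top_meet y z) = (x <= y) && (x <= z).
Proof.
by case: x y z => [a|] [b|] [c|] //; rewrite /Order.le /= ?andbT // lexI.
Qed.

Fact add_top_joinP x y z :
  (add_top_join x y <= z) = (x <= z) && (y <= z).
Proof.
by case: x y z => [a|] [b|] [c|] //; rewrite /Order.le /= ?andbF // leUx.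
Qed.

HB.instance Definition _ := Order.POrder_MeetJoin_isLattice.Build d add_top
  add_top_meetP add_top_joinP.

Fact add_top_le0x x : (Some \bot : add_top) <= x.
Proof. by case: x => [a|] //; rewrite /Order.le /= le0x. Qed.
HB.instance Definition _ := Order.hasBottom.Build d add_top add_top_le0x.

Fact add_top_lex1 x : x <= (None : add_top).
Proof. by case: x. Qed.
HB.instance Definition _ := Order.hasTop.Build d add_top add_top_lex1.

Definition inj_top (a : L) : add_top := Some a.

(** Dropping the new top is a lattice homomorphism onto [L], because the top of
[L] was already neutral for meets and absorbing for joins there. *)
Definition drop_top (x : add_top) : L := odflt \top x.

(** The Boolean tells whether the new top is collapsed with the old one.  Both
conditions are pulled back along homomorphisms: [drop_top] to [L], and [isSome]
to the two-element chain. *)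
Definition extend_Con (p : {set L * L} * bool) : {set add_top * add_top} :=
  [set q | ((drop_top q.1, drop_top q.2) \in p.1) &&
           (p.2 || (isSome q.1 == isSome q.2))].

Lemma extend_Con_in p : p.1 \in Con L -> extend_Con p \in Con add_top.
Proof.
case: p => r b /= /ConP[rxx rsym rtr rI rU].
have dI : {morph drop_top : x y / x `&` y}.
  by case=> [a|] [c|] //=; rewrite ?meet1x ?meetx1.
have dU : {morph drop_top : x y / x `|` y}.
  by case=> [a|] [c|] //=; rewrite ?join1x ?joinx1.
have sI (x y : add_top) : isSome (x `&` y) = isSome x || isSome y.
  by case: x y => [a|] [c|].
have sU (x y : add_top) : isSome (x `|` y) = isSome x && isSome y.
  by case: x y => [a|] [c|].
apply/ConP; split=> [x|x y|x y z|x y u v|x y u v]; rewrite !inE /=.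
- by rewrite rxx eqxx orbT.
- by rewrite eq_sym => /andP[/rsym-> ->].
- move=> /andP[xy b1] /andP[yz b2]; rewrite (rtr _ _ _ xy yz) /=.
  by case: b b1 b2 => //= /eqP-> /eqP->.
- move=> /andP[xy b1] /andP[uv b2]; rewrite !dI !sI rI //=.
  by case: b b1 b2 => //= /eqP-> /eqP->.
- move=> /andP[xy b1] /andP[uv b2]; rewrite !dU !sU rU //=.
  by case: b b1 b2 => //= /eqP-> /eqP->.
Qed.

Lemma extend_Con_inj : {in setX (Con L) [set: bool] &, injective extend_Con}.
Proof.
move=> [r b] [s c]; rewrite !in_setX => /andP[/= /ConP[rxx _ _ _ _] _].
move=> /andP[/= /ConP[sxx _ _ _ _] _].
move=> /setP E; congr (_, _).
  apply/setP=> -[x y]; have := E (inj_top x, inj_top y).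
  by rewrite !inE /= !eqxx !orbT !andbT.
have := E (inj_top \top, None); rewrite !inE /= rxx sxx /=.
by rewrite !orbF.
Qed.

(** A congruence that relates [None] to some a relates it to the old top, by
joining with the old top; so the block of [None] adds a single Boolean to the
restriction to [L]. *)
Lemma Con_extend_eq (r : {set add_top * add_top}) : r \in Con add_top ->
  exists2 p, p.1 \in Con L & r = extend_Con p.
Proof.
case/ConP=> rxx rsym rtr rI rU.
pose r0 : {set L * L} := [set p | (inj_top p.1, inj_top p.2) \in r].
pose b := (inj_top \top, None) \in r.
have bP a : (inj_top a, None) \in r = b && ((a, \top) \in r0).
  apply/idP/andP => [a1|[b1]]; last by rewrite inE /=; move/rtr; apply.
  have b1 : b.
    have := rU _ _ _ _ (rxx (inj_top \top)) a1.
    by rewrite /b /= [_ `|` inj_top a]/Order.join /= join1x.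
  by split=> //; rewrite inE; apply: rtr a1 (rsym _ _ b1).
exists (r0, b).
  apply/ConP; split=> [x|x y|x y z|x y u v|x y u v]; rewrite !inE /=.
  - exact: rxx.
  - exact: rsym.
  - exact: rtr.
  - by move=> xy uv; apply: (rI _ _ _ _ xy uv).
  - by move=> xy uv; apply: (rU _ _ _ _ xy uv).
apply/setP=> -[[x|] [y|]]; rewrite inE /=.
- by rewrite eqxx orbT andbT inE.
- by rewrite -/(inj_top x) bP orbF andbC.
- rewrite orbF andbC; apply/idP/andP => [/rsym|[b1 xy]].
    rewrite -/(inj_top y) bP => /andP[b1]; rewrite !inE.
    by split=> //; apply: rsym.
  apply: (rsym); rewrite -/(inj_top y) bP b1 /=.
  by move: xy; rewrite !inE; apply: rsym.
- by rewrite rxx inE rxx eqxx orbT.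
Qed.

Lemma card_Con_add_top : #|Con add_top| = (#|Con L| * 2)%N.
Proof.
rewrite -[2%N]card_bool -cardsT -cardsX -(card_in_imset extend_Con_inj).
apply: eq_card => r; apply/idP/imsetP => [/Con_extend_eq[[s b] sC ->]|[[s b]]].
  by exists (s, b); rewrite // in_setX sC in_setT.
by rewrite in_setX => /andP[sC _] ->; apply: extend_Con_in.
Qed.

Lemma covers_add_top (a b : L) : covers a b -> covers (inj_top a) (inj_top b).
Proof.
have lt_inj (u v : L) : (inj_top u < inj_top v) = (u < v) by rewrite !lt_leAnge.
by case=> ab nz; split=> [|[c|]]; rewrite ?lt_inj => // /andP[]; rewrite ?lt_inj.
Qed.

End AddTop.

Arguments inj_top {d L} a.

(** * Non-dismantlability *)

Section Dismantling.
Local Open Scope order_scope.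
Variables (d : Order.disp_t) (L : finLatticeType d).

(** In a dismantling sequence consider the first sublattice [C j.+1] that
contains [S].  It exceeds [C j] by one element x, which lies in [S]; the two
other elements of [S] that produce x lie in [C j], so x does as well. *)
Lemma reducible_subset_not_dismantlable (S : {set L}) :
    (1 < #|S|)%N ->
    (forall x, x \in S -> exists y z, [/\ y \in S :\ x, z \in S :\ x &
        x = y `&` z \/ x = y `|` z]) ->
  ~ dismantlable L.
Proof.
move=> S1 Sred [C [Csub Cprop CT]].
have L1 : (1 <= #|L|)%N by apply: leq_trans (ltnW S1) (max_card _).
have ex : exists i, (1 <= i <= #|L|)%N && (S \subset C i).
  by exists #|L|; rewrite L1 leqnn CT subsetT.
case: (ex_minnP ex) => -[//|j] /andP[/andP[_ jL] Sj] jmin.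
have j_gt0 : (0 < j)%N.
  have [_ c] := Csub j.+1 jL.
  by case: j c {jmin jL} Sj => // c /subset_leq_card; rewrite c leqNgt S1.
have [x xS xNj] : exists2 x, x \in S & x \notin C j.
  apply/subsetPn; apply/negP => SCj; have := jmin j.
  by rewrite ltnn j_gt0 SCj (ltnW jL) => /(_ isT).
have [[_ CjI CjU] cj] := Csub j (introT andP (conj j_gt0 (ltnW jL))).
have [_ cj1] := Csub j.+1 jL.
have Cj1 : C j.+1 = x |: C j.
  apply/eqP; rewrite eq_sym eqEcard cj1 cardsU1 xNj cj add1n leqnn andbT.
  rewrite subUset sub1set (subsetP Sj) //=.
  by apply: proper_sub; apply: Cprop; rewrite j_gt0.
have inCj y : y \in S :\ x -> y \in C j.
  by rewrite in_setD1 => /andP[yx /(subsetP Sj)]; rewrite Cj1 !inE (negPf yx).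
have [y [z [/inCj yj /inCj zj xE]]] := Sred x xS.
by case/negP: xNj; case: xE => ->; [apply: CjI | apply: CjU].
Qed.

End Dismantling.

(** * The cube as a sublattice *)

Section Cube.
Local Open Scope order_scope.
Local Notation cube := {set 'I_3}.

(** A set with two distinct elements is the union of the results of removing
either of them; a subset of a three-element set without two distinct elements
misses two, and is the intersection of the results of adding either. *)
Lemma cube_reducible (A : cube) : exists B C : cube,
  [/\ B != A, C != A & A = B `&` C \/ A = B `|` C].
Proof.
have [A1|A1] := ltnP 1 #|A|.
  have [i [j [iA jA ij]]] := card_gt1P A1.
  exists (A :\ i), (A :\ j); split.
  - by apply/eqP=> /setP/(_ i); rewrite !inE eqxx iA.
  - by apply/eqP=> /setP/(_ j); rewrite !inE eqxx jA.
  right; apply/setP=> k; rewrite Order.SetSubsetOrder.joinEsubset !inE.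
  case: eqVneq => [->|]; rewrite ?ij ?andbF ?orbF //.
  by case: (k \in A); rewrite ?orbT ?andbF.
have A2 : (1 < #|~: A|)%N.
  by rewrite -(leq_add2l #|A|) cardsC card_ord; case: #|A| A1 => [|[]].
have [i [j [iA jA ij]]] := card_gt1P A2.
rewrite !inE in iA jA.
exists (i |: A), (j |: A); split.
- by apply/eqP=> /setP/(_ i); rewrite !inE eqxx (negPf iA).
- by apply/eqP=> /setP/(_ j); rewrite !inE eqxx (negPf jA).
left; apply/setP=> k; rewrite Order.SetSubsetOrder.meetEsubset !inE.
case: eqVneq => [->|]; rewrite ?(negPf ij) /= ?(negPf iA) //.
by case: (k \in A); rewrite ?orbT ?andbF.
Qed.

(** Preservation of coverings is required so that edges of a diagram of the cube
are edges of the diagram of [L]. *)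
Definition cube_embedding (d : Order.disp_t) (L : finLatticeType d)
    (f : cube -> L) : Prop :=
  [/\ injective f,
      {morph f : A B / A `&` B},
      {morph f : A B / A `|` B}
    & forall A B : cube, covers A B -> covers (f A) (f B)].

Lemma cube_embedding_not_dismantlable (d : Order.disp_t) (L : finLatticeType d)
  (f : cube -> L) : cube_embedding f -> ~ dismantlable L.
Proof.
case=> f_inj fI fU _.
apply: (@reducible_subset_not_dismantlable _ _ (f @: [set: cube])).
  by rewrite card_imset // -powersetT card_powerset cardsT card_ord.
move=> _ /imsetP[A _ ->]; have [B [C [BA CA AE]]] := cube_reducible A.
exists (f B), (f C); rewrite !in_setD1 !(inj_eq f_inj) BA CA !imset_f ?inE //.
by split=> //; case: AE => AE; [left; rewrite -fI -AE | right; rewrite -fU -AE].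
Qed.

Lemma covers_add1 (A : cube) (i : 'I_3) : i \notin A -> covers A (i |: A).
Proof.
have ltE (B C : cube) : (B < C) = (B \proper C).
  by rewrite lt_neqAle Order.SetSubsetOrder.leEsubset properEneq.
move=> iA; split=> [|Z]; rewrite !ltE.
  by rewrite properE subsetUr subUset sub1set (negPf iA).
case/andP=> /proper_card AZ /proper_card; rewrite cardsU1 iA add1n ltnS.
by rewrite leqNgt AZ.
Qed.

End Cube.

(** * Chains in a diagram as graphs of functions of the height *)

Section Polylines.
Local Open Scope ring_scope.
Variables (R : realType) (d : Order.disp_t) (L : finLatticeType d).
Variable pos : L -> R * R.
Implicit Types (x y z : L) (s t : seq L) (h : R).

Fixpoint saturated x s : Prop :=
  if s is y :: s' then covers x y /\ saturated y s' else True.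

(** The first coordinate, at height h, of the line through the points of x and
y. *)
Definition edge_line x y h : R :=
  (pos x).1 + (h - (pos x).2) / ((pos y).2 - (pos x).2) *
    ((pos y).1 - (pos x).1).

(** The first coordinate, at height h, of the polygonal line through the points
of x and of the members of s.  Clamping the height at each vertex makes the
formula a composition of continuous functions, so that continuity needs no
gluing; the chain must ascend for the formula to have its meaning. *)
Fixpoint polyline x s h : R :=
  if s is y :: s' then
    edge_line x y (Num.min h (pos y).2) +
      (polyline y s' (Num.max h (pos y).2) - (pos y).1)
  else (pos x).1.

Lemma edge_line_cont x y : continuous (edge_line x y).
Proof.
move=> h; apply: cvgD; first exact: cvg_cst.
apply: cvgMl; apply: cvgMl; apply: cvgB; first exact: cvg_id.
exact: cvg_cst.
Qed.

Lemma polyline_cont x s : continuous (polyline x s).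
Proof.
elim: s x => [|y s IHs] x h /=; first exact: cvg_cst.
have cst : continuous (fun _ : R => (pos y).2 : R^o) by exact: cst_continuous.
have idc : continuous (fun h : R => h : R^o) by move=> ?; exact: cvg_id.
apply: cvgD; last (apply: cvgB; last exact: cvg_cst).
  apply: (@continuous_comp _ _ _ (fun h => Num.min h (pos y).2)).
    exact: continuous_min (idc h) (cst h).
  exact: edge_line_cont.
apply: (@continuous_comp _ _ _ (fun h => Num.max h (pos y).2)).
  exact: continuous_max (idc h) (cst h).
exact: IHs.
Qed.

Hypothesis Hpos : is_Hasse_diagram pos.

Let pos_covers x y : covers x y -> (pos x).2 < (pos y).2.
Proof. by case: Hpos => _ H _ [/H]. Qed.

Lemma edge_line_start x y : edge_line x y (pos x).2 = (pos x).1.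
Proof. by rewrite /edge_line subrr !mul0r addr0. Qed.

Lemma edge_line_end x y : covers x y -> edge_line x y (pos y).2 = (pos y).1.
Proof.
move=> /pos_covers xy; rewrite /edge_line divff ?subr_eq0 ?gt_eqF //.
by rewrite mul1r addrC subrK.
Qed.

Lemma edge_line_on_segment x y h : covers x y ->
  (pos x).2 <= h <= (pos y).2 ->
  on_segment (pos x) (pos y) (edge_line x y h, h).
Proof.
move=> /pos_covers xy /andP[xh hy].
have dxy : 0 < (pos y).2 - (pos x).2 by rewrite subr_gt0.
exists ((h - (pos x).2) / ((pos y).2 - (pos x).2)).
  by rewrite divr_ge0 ?ler_pdivrMr ?mul1r ?lerD2r ?subr_ge0 // ltW.
congr (_, _); rewrite /edge_line; first by ring.
by field; rewrite gt_eqF.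
Qed.

Lemma polyline_start x s : saturated x s -> polyline x s (pos x).2 = (pos x).1.
Proof.
elim: s x => [//|y s IHs] x /= [/pos_covers /ltW xy ys].
by rewrite min_l // max_r // edge_line_start IHs // subrr addr0.
Qed.

Lemma polyline_low x y s h : saturated x (y :: s) -> h <= (pos y).2 ->
  polyline x (y :: s) h = edge_line x y h.
Proof.
move=> /= [_ ys] hy.
by rewrite min_l // max_r // polyline_start // subrr addr0.
Qed.

Lemma polyline_high x y s h : saturated x (y :: s) -> (pos y).2 <= h ->
  polyline x (y :: s) h = polyline y s h.
Proof.
move=> /= [xy _] yh.
by rewrite min_r // max_l // edge_line_end // addrC subrK.
Qed.

Lemma saturated_last_le x s : saturated x s -> (pos x).2 <= (pos (last x s)).2.
Proof.
elim: s x => [//|y s IHs] x /= [/pos_covers /ltW xy /IHs].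
exact: le_trans.
Qed.

Lemma polyline_end x s : saturated x s ->
  polyline x s (pos (last x s)).2 = (pos (last x s)).1.
Proof.
elim: s x => [//|y s IHs] x sat; have [_ ys] := sat.
by rewrite polyline_high ?IHs //= saturated_last_le.
Qed.

Lemma polyline_on_segment x s h : saturated x s ->
    (pos x).2 < h <= (pos (last x s)).2 ->
  exists u v, [/\ covers u v, u \in x :: s, v \in s &
    on_segment (pos u) (pos v) (polyline x s h, h)].
Proof.
elim: s x => [|y s IHs] x sat /andP[xh hl].
  by move: hl; rewrite /= leNgt xh.
have [xy ys] := sat; have [hy|yh] := leP h (pos y).2.
  exists x, y; split; rewrite ?inE ?eqxx //.
  rewrite polyline_low //.
  by apply: edge_line_on_segment; rewrite ?(ltW xh).
have [||u [v [uv us vs uvh]]] := IHs y => //; first by rewrite yh.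
exists u, v; split=> //; rewrite ?in_cons ?vs ?orbT //.
  by rewrite -in_cons us orbT.
by rewrite polyline_high // ltW.
Qed.

Lemma on_segment_vertex x y z :
  covers x y -> on_segment (pos x) (pos y) (pos z) -> z = x \/ z = y.
Proof. by case: Hpos => _ _ H /H; apply. Qed.

Hypothesis Ppos : is_planar_diagram pos.

(** A common point would lie on two edges with distinct upper ends, so it would
be a vertex common to the two chains; only their starting point x is. *)
Lemma polylines_disjoint x s t h :
    saturated x s -> saturated x t -> ~~ has [in s] t ->
    (pos x).2 < h -> h <= (pos (last x s)).2 -> h <= (pos (last x t)).2 ->
  polyline x s h != polyline x t h.
Proof.
move=> sats satt /hasPn st xh hs ht; apply/eqP=> E.
have [|u [v [uv us vs uvh]]] := polyline_on_segment sats (h := h).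
  by rewrite xh.
have [|u' [v' [uv' ut' vt' uvh']]] := polyline_on_segment satt (h := h).
  by rewrite xh.
have neq : (u, v) <> (u', v').
  by move=> [_ vv']; have := st _ vt'; rewrite /= -vv' vs.
rewrite -E in uvh'; have [z zE] := Ppos uv uv' neq uvh uvh'.
have zs : z \in x :: s.
  move: uvh; rewrite zE => /(on_segment_vertex uv)[] -> //.
  by rewrite in_cons vs orbT.
have zt : z \in x :: t.
  move: uvh'; rewrite zE => /(on_segment_vertex uv')[] -> //.
  by rewrite in_cons vt' orbT.
have zx : z = x.
  move: zt; rewrite in_cons => /orP[/eqP//|/st /negPf zNs].
  by move: zs; rewrite in_cons [z \in s]zNs orbF => /eqP.
by move: xh; rewrite -zx -zE ltxx.
Qed.

(** Chains that share only their starting point never meet above it, so by the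
intermediate value theorem they keep their left-to-right order. *)
Lemma polylines_order x s t h h' :
    saturated x s -> saturated x t -> ~~ has [in s] t ->
    (pos x).2 < h -> h <= h' ->
    h' <= (pos (last x s)).2 -> h' <= (pos (last x t)).2 ->
  polyline x s h < polyline x t h -> polyline x s h' < polyline x t h'.
Proof.
move=> sats satt st xh hh' hs ht lth; rewrite ltNge; apply/negP=> gth'.
pose f k := polyline x t k - polyline x s k.
have [||k] := @IVT R f h h' 0 hh'.
- apply: continuous_subspaceT => k.
  by apply: cvgB; apply: polyline_cont.
- rewrite /f min_r ?max_l ?subr_ge0 ?subr_le0 ?gth' ?(ltW lth) //.
    apply: le_trans (_ : 0 <= _); by rewrite ?subr_ge0 ?subr_le0 // ltW.
  apply: le_trans (_ : 0 <= _); by rewrite ?subr_ge0 ?subr_le0 // ltW.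
rewrite in_itv /= => /andP[hk kh'] /eqP; rewrite subr_eq0 eq_sym; apply/negP.
apply: polylines_disjoint => //; first exact: lt_le_trans hk.
  exact: le_trans hs.
exact: le_trans ht.
Qed.

End Polylines.

(** * Non-planarity *)

Local Open Scope ring_scope.

Lemma median_I3 (R : realDomainType) (g : 'I_3 -> R) : injective g ->
  exists i j k, [/\ i != j, j != k, i != k, g i < g j & g j < g k].
Proof.
move=> g_inj; pose a : 'I_3 := ord0; pose b : 'I_3 := lift ord0 ord0.
pose c : 'I_3 := ord_max.
have [ab bc ac] : [/\ g a != g b, g b != g c & g a != g c].
  by rewrite !(inj_eq g_inj).
case: (ltgtP (g a) (g b)) ab => // ab _.
  case: (ltgtP (g b) (g c)) bc => // bc _; first by exists a, b, c.
  case: (ltgtP (g a) (g c)) ac => // ac _; first by exists a, c, b.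
  by exists c, a, b.
case: (ltgtP (g a) (g c)) ac => // ac _; first by exists b, a, c.
case: (ltgtP (g b) (g c)) bc => // bc _; first by exists b, c, a.
by exists c, b, a.
Qed.

(** The middle chain consists of sets containing the middle atom j, and the
outer chains of sets avoiding j; this gives the disjointness required to
compare them.  The two outer chains meet at the point of the join of i and k,
with the middle chain strictly between them at that height. *)
Lemma cube_embedding_not_planar (R : realType) (d : Order.disp_t)
  (L : finLatticeType d) (f : {set 'I_3} -> L) :
  cube_embedding f -> ~ planar R L.
Proof.
case=> f_inj _ _ fcov [pos [Hpos Ppos]].
have fcov1 (A : {set 'I_3}) i : i \notin A -> covers (f A) (f (i |: A)).
  by move=> iA; apply/fcov/covers_add1.
have atom i : covers (f set0) (f [set i]).
  by rewrite -[[set i]]setU0; apply: fcov1; rewrite inE.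
have pair a b : a != b -> covers (f [set b]) (f [set a; b]).
  by move=> ab; apply: fcov1; rewrite inE.
have pair' a b : a != b -> covers (f [set a]) (f [set a; b]).
  by rewrite eq_sym setUC; apply: pair.
have coatom a b c : a != b -> b != c -> a != c ->
    covers (f [set a; b]) (f [set: 'I_3]).
  move=> ab bc ac; rewrite (_ : setT = c |: [set a; b]).
    by apply: fcov1; rewrite !inE negb_or !(eq_sym c) ac bc.
  apply/eqP; rewrite eq_sym eqEcard subsetT cardsT card_ord cardsU1 cards2.
  by rewrite !inE !(eq_sym c) (negPf ac) (negPf bc) ab.
have disj a (s t : seq {set 'I_3}) :
    all (fun A : {set 'I_3} => a \notin A) s ->
    all (fun A : {set 'I_3} => a \in A) t ->
    ~~ has [in map f s] (map f t).
  move=> /allP sa /allP ta; apply/hasPn=> _ /mapP[A /ta aA ->] /=.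
  by rewrite mem_map //; apply: contraL aA => /sa.
have [_ pos_lt _] := Hpos.
have height_lt x y : covers x y -> (pos x).2 < (pos y).2 by case=> /pos_lt.
(* At the height of the lowest atom all three edges are still present. *)
pose h := Num.min (pos (f [set (ord0 : 'I_3)])).2
  (Num.min (pos (f [set (lift ord0 ord0 : 'I_3)])).2
     (pos (f [set (ord_max : 'I_3)])).2).
have h0 : (pos (f set0)).2 < h by rewrite !lt_min !height_lt.
have h_le i : h <= (pos (f [set i])).2.
  have [->|] := eqVneq i ord0; first by rewrite ge_min lexx.
  have [->|] := eqVneq i ord_max; first by rewrite !ge_min lexx !orbT.
  case: i => -[|[|[|]]] // i1 _ _; rewrite !ge_min.
  by rewrite (_ : Ordinal i1 = lift ord0 ord0) ?lexx ?orbT //; apply: val_inj.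
pose g i := edge_line pos (f set0) (f [set i]) h.
have gE i s : saturated (f [set i]) s ->
    polyline pos (f set0) (f [set i] :: s) h = g i.
  by move=> sat; apply: polyline_low.
have g_inj : injective g.
  move=> i j gij; apply/eqP/negPn/negP=> ij.
  have /negP[] : polyline pos (f set0) [:: f [set i]] h !=
                 polyline pos (f set0) [:: f [set j]] h.
    apply: polylines_disjoint => //=.
    apply: (disj j [:: [set i]] [:: [set j]]); rewrite /= !inE ?eqxx //.
    by rewrite andbT eq_sym.
  by rewrite !gE // gij.
have [i [j [k [ij jk ik gij gjk]]]] := median_I3 g_inj.
have ji : j != i by rewrite eq_sym.
(* The bottom is not listed: it is the common starting point of the chains. *)
pose left := [:: [set i]; [set i; k]].
pose middle := [:: [set j]; [set i; j]; setT].
pose right := [:: [set k]; [set i; k]].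
have satl : saturated (f set0) (map f left).
  by split; [exact: atom | split; [exact: pair' | ]].
have satm : saturated (f set0) (map f middle).
  split; first exact: atom.
  by split; [exact: pair | split; [exact: (coatom i j k) | ]].
have satr : saturated (f set0) (map f right).
  by split; [exact: atom | split; [exact: pair | ]].
have jm : all (fun A : {set 'I_3} => j \in A) middle.
  by rewrite /= !inE eqxx orbT.
have jl : all (fun A : {set 'I_3} => j \notin A) left.
  by rewrite /= !inE (negPf ji) (negPf jk).
have jr : all (fun A : {set 'I_3} => j \notin A) right.
  by rewrite /= !inE (negPf ji) (negPf jk).
pose h' := (pos (f [set i; k])).2.
have hh' : h <= h'.
  by apply: le_trans (h_le i) (ltW (height_lt _ _ (pair' _ _ ik))).
have h'T : h' <= (pos (f setT)).2.
  by apply/ltW/height_lt; apply: (coatom i k j); rewrite // eq_sym.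
have lm : polyline pos (f set0) (map f left) h' <
          polyline pos (f set0) (map f middle) h'.
  apply: (polylines_order Hpos Ppos satl satm (h := h)) => //.
    exact: disj jl jm.
  by rewrite !gE //; [case: satm | case: satl].
have mr : polyline pos (f set0) (map f middle) h' <
          polyline pos (f set0) (map f right) h'.
  apply: (polylines_order Hpos Ppos satm satr (h := h)) => //.
    by rewrite has_sym; apply: disj jr jm.
  by rewrite !gE //; [case: satr | case: satm].
have := lt_trans lm mr.
by rewrite (polyline_end Hpos satl) (polyline_end Hpos satr) ltxx.
Qed.

(** * The lattices *)

Theorem mainTheorem2 (R : realType) (n : nat) (hn : (8 <= n)%N) :
  exists (d : Order.disp_t) (L : finLatticeType d),
    [/\ #|{: L}| = n,
        ~ dismantlable L,
        #|Con L| = (2 ^ (n - 5))%N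
      & ~ planar R L].
Proof.
(* Non-dismantlability and non-planarity are not carried through the induction
themselves: the embedded cube, which gives both, is. *)
suff [d [L [cardL ConL [f fE]]]] : exists d (L : finTBLatticeType d),
    [/\ #|L| = n, #|Con L| = (2 ^ (n - 5))%N &
        exists f : {set 'I_3} -> L, cube_embedding f].
  exists d, L; split=> //; first exact: cube_embedding_not_dismantlable fE.
  exact: cube_embedding_not_planar fE.
elim: n hn => [//|n IHn]; rewrite leq_eqVlt => /predU1P[<-|n8].
  have c8 : #|{set 'I_3}| = 8%N.
    by rewrite -cardsT -powersetT card_powerset cardsT card_ord.
  exists _, {set 'I_3}; split=> //; first by rewrite card_Con_boolean.
  by exists id; split=> [A B|A B|A B|A B].
have [d [L [cardL ConL [f [f_inj fI fU fcov]]]]] := IHn n8.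
have n5 : (5 <= n)%N by apply: (@leq_trans 8).
exists d, (add_top L); split.
- by rewrite card_option cardL.
- by rewrite card_Con_add_top ConL subSn // expnSr.
exists (inj_top \o f); split=> [||A B|A B /fcov].
- by apply: inj_comp f_inj => a b [].
- by move=> A B; rewrite /= fI.
- by rewrite /= fU.
exact: covers_add_top.
Qed.
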